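(* Let $\omega^{\omega^\alpha}$ be a principal ordinal and $W=W(\omega^{\omega^\alpha})=\{x:x<\omega^{\omega^\alpha}\}$. Two operations $+,\cdot$ on $W$ are the Hessenberg natural sum and natural product if and only if they satisfy, for all $x,y\in W$, the inductive rules $$(p_+)\quad x+y=S\big(\{x+W(y)\}\cup\{W(x)+y\}\big),$$ $$(p)\quad x\cdot y=S\big(\{W(x)\cdot y+x\cdot W(y)-W(x)\cdot W(y)\}\cap W(\gamma+1)\big).$$
   Context: $W(x)=\{z:z<x\}$. For a set $A$ of ordinals, $S(A)$ (the sequent of $A$) is the least ordinal strictly greater than every element of $A$. Set expressions are elementwise: $\{x+W(y)\}=\{x+y':y'<y\}$, $\{W(x)+y\}=\{x'+y:x'<x\}$, and $\{W(x)\cdot y+x\cdot W(y)-W(x)\cdot W(y)\}=\{x'\cdot y+x\cdot y'-x'\cdot y': x'<x,\ y'<y\}$. Here $\gamma$ is a fixed ordinal with $\omega^{\omega^\alpha}<\gamma$, the differences in $(p)$ are taken in the Grothendieck group of the cancellative commutative monoid $W$ under natural sum (in which $W$ is embedded), and intersecting with $W(\gamma+1)$ means keeping only those elements that are ordinals in $W(\gamma+1)$. Hessenberg operations: if $x=\sum_i\omega^{\xi_i}p_i$, $y=\sum_i\omega^{\xi_i}q_i$ are Cantor normal forms (padded with zero coefficients to a common set of exponents), the natural sum is $\sum_i\omega^{\xi_i}(p_i+q_i)$; the natural product is obtained by distributivity and associativity from $\omega^{\xi}\cdot\omega^{\eta}=\omega^{\xi(+)\eta}$, where $(+)$ is the natural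 sum. *)

(* Defs.v *)
From HB Require Import structures.
From mathcomp Require Import all_boot all_order.
From mathcomp Require Import generic_quotient boolp classical_sets.

Set Implicit Arguments.
Unset Strict Implicit.
Unset Printing Implicit Defensive.

Import Order.TTheory.
Local Open Scope order_scope.
Local Open Scope classical_set_scope.
Local Open Scope quotient_scope.

(** * Ordinals

  A well-founded tree [Lim f] is read as the ordinal
  sup {rank (f i) + 1 | i}; [Ord] is the quotient of trees by equality of
  ranks.  It is (classically) the well-ordered class of all ordinals of the
  universe over which the index types [I] range; every family of ordinals
  indexed by such a type is strictly bounded (lemma [bounded_family]). *)

Inductive tree : Type := Lim (I : Type) (f : I -> tree).

Fixpoint tle (x y : tree) {struct x} : Prop :=
  let: Lim _ f := x in let: Lim _ g := y in
  forall i, exists j, tle (f i) (g j).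

Lemma tle_refl x : tle x x.
Proof. by elim: x => I f IH /= i; exists i. Qed.

Lemma tle_trans x y z : tle x y -> tle y z -> tle x z.
Proof.
elim: x y z => I f IH [J g] [K h] /= fg gh i.
by have [j /IH fj] := fg i; have [k /fj] := gh j; exists k.
Qed.

Lemma tle_total x y : tle x y \/ tle y x.
Proof.
elim: x y => I f IH [J g].
have [|nfg] := pselect (tle (Lim f) (Lim g)); [by left | right].
have [i nfi] : exists i, forall j, ~ tle (f i) (g j).
  by apply: contrapT => /forallNP H; apply: nfg => i /=;
     apply: contrapT => /forallNP nE; exact: (H i).
by move=> j; exists i; case: (IH i (g j)) => // /nfi.
Qed.

Lemma tlt_lim I (f : I -> tree) i : ~ tle (Lim f) (f i).
Proof.
suff H x : forall I (f : I -> tree) i, tle x (f i) -> ~ tle (Lim f) x.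
  by apply: H; apply: tle_refl.
elim: x => K h IH {}I {}f {}i hi fh; have /= [k hk] := fh i.
case: (f i) hi hk => L g hi hk; have [l hl] := hi k.
exact: IH hl hk.
Qed.

Lemma tlt_ex x I (f : I -> tree) : ~ tle (Lim f) x -> exists i, tle x (f i).
Proof.
elim: x I f => K h IH I f nfh.
have [i nfi] : exists i, forall k, ~ tle (f i) (h k).
  by apply: contrapT => /forallNP H; apply: nfh => i /=;
     apply: contrapT => /forallNP nE; exact: (H i).
by exists i; case: (f i) nfi => L g nfi k /=; apply: IH; exact: nfi.
Qed.

Lemma tlt_wf : well_founded (fun x y => ~ tle y x).
Proof.
suff H x : forall y, tle y x -> Acc (fun x y => ~ tle y x) y.
  by move=> x; apply: (H x); apply: tle_refl.
elim: x => I f IH y yf; constructor => z nyz.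
have /tlt_ex [i zi] : ~ tle (Lim f) z by move=> fz; apply: nyz; apply: tle_trans fz.
exact: IH zi.
Qed.

HB.instance Definition _ := gen_eqMixin tree.
HB.instance Definition _ := gen_choiceMixin tree.

Definition teq (x y : tree) : bool := `[< tle x y /\ tle y x >].

Lemma teq_refl : reflexive teq.
Proof. by move=> x; apply/asboolP; split; apply: tle_refl. Qed.

Lemma teq_sym : symmetric teq.
Proof. by move=> x y; apply/asboolP/asboolP => -[]. Qed.

Lemma teq_trans : transitive teq.
Proof.
move=> y x z /asboolP[xy yx] /asboolP[yz zy]; apply/asboolP.
by split; [apply: tle_trans yz | apply: tle_trans yx].
Qed.

Canonical teq_equiv := EquivRel teq teq_refl teq_sym teq_trans.

Definition Ord := {eq_quot teq}.
HB.instance Definition _ := Choice.on Ord.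

Definition ole (x y : Ord) : bool := `[< tle (repr x) (repr y) >].

Lemma ole_refl : reflexive ole.
Proof. by move=> x; apply/asboolP; apply: tle_refl. Qed.

Lemma ole_anti : antisymmetric ole.
Proof.
move=> x y /andP[/asboolP xy /asboolP yx]; rewrite -[x]reprK -[y]reprK.
by apply/eqquotP; apply/asboolP.
Qed.

Lemma ole_trans : transitive ole.
Proof.
by move=> y x z /asboolP xy /asboolP yz; apply/asboolP; apply: tle_trans yz.
Qed.

Lemma ole_total : total ole.
Proof.
move=> x y; apply/orP.
by case: (tle_total (repr x) (repr y)) => ?; [left|right]; apply/asboolP.
Qed.

Fact ord_display : Order.disp_t. Proof. exact: (Order.Disp tt tt). Qed.

HB.instance Definition _ :=
  Order.Le_isPOrder.Build ord_display Ord ole_refl ole_anti ole_trans.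
HB.instance Definition _ :=
  Order.POrder_isTotal.Build ord_display Ord ole_total.

Definition rank (t : tree) : Ord := \pi_Ord t.

Lemma rank_repr (x : Ord) : rank (repr x) = x.
Proof. exact: reprK. Qed.

Lemma ole_pi (t u : tree) : (rank t <= rank u) <-> tle t u.
Proof.
have piK v : tle (repr (rank v)) v /\ tle v (repr (rank v)).
  by apply/asboolP; apply/(@eqquotP _ _ Ord); rewrite reprK.
have [[t1 t2] [u1 u2]] := (piK t, piK u).
split=> [/asboolP H|H]; last apply/asboolP.
  exact: tle_trans t2 (tle_trans H u1).
exact: tle_trans t1 (tle_trans H u2).
Qed.

Lemma olt_wf : well_founded (fun x y : Ord => x < y).
Proof.
move=> x; rewrite -[x]rank_repr; elim: (tlt_wf (repr x)) => {x} t _ IH.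
constructor=> y; rewrite -[y]rank_repr ltNge => /negP yx; apply: IH => ty.
exact/yx/ole_pi.
Qed.

Lemma bounded_family (I : Type) (f : I -> Ord) : exists u, forall i, f i < u.
Proof.
exists (rank (Lim (fun i => repr (f i)))) => i.
rewrite -{1}[f i]rank_repr ltNge; apply/negP => /ole_pi.
exact: (@tlt_lim I (fun i => repr (f i)) i).
Qed.

Lemma bounded_image (f : Ord -> Ord) (x : Ord) :
  exists u, forall y, y < x -> f y < u.
Proof.
rewrite -[x]rank_repr; elim: (repr x) => {x} I g IH.
have [u uP] := choice IH.
have [v vP] := bounded_family (fun i => Order.max (u i) (f (rank (g i)))).
exists v => y; rewrite -[y]rank_repr ltNge => /negP gy.
have /tlt_ex [i] : ~ tle (Lim g) (repr y) by move=> H; apply/gy/ole_pi.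
move=> /ole_pi; rewrite !rank_repr le_eqVlt => /predU1P[-> | yi].
  by apply: le_lt_trans (vP i); rewrite le_max lexx orbT.
apply: lt_trans (uP i _ yi) _; apply: le_lt_trans (vP i).
by rewrite le_max lexx.
Qed.

Lemma olt_least (A : set Ord) x : A x ->
  exists2 z, A z & forall y, A y -> z <= y.
Proof.
elim: (olt_wf x) => {}x _ IH Ax.
have [[y Ay yx]|nE] := pselect (exists2 y, A y & y < x); first exact: IH Ay.
by exists x => // y Ay; rewrite leNgt; apply/negP => yx; apply: nE; exists y.
Qed.

Definition ozero : Ord := rank (Lim (fun i : void => match i with end)).

Lemma ole0 x : ozero <= x.
Proof. by rewrite -[x]rank_repr; apply/ole_pi; case: (repr x) => I f []. Qed.

Definition W (x : Ord) : set Ord := [set z | z < x].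

(* The fallback [ozero] is irrelevant: see [sequentP]. *)
Definition sequent (A : set Ord) : Ord :=
  xget ozero [set z | (forall a, A a -> a < z) /\
                      (forall z', (forall a, A a -> a < z') -> z <= z')].

Lemma sequentP (A : set Ord) u : (forall a, A a -> a < u) ->
  (forall a, A a -> a < sequent A) /\
  (forall z, (forall a, A a -> a < z) -> sequent A <= z).
Proof.
move=> Au; have [z Az zmin] := @olt_least [set z | forall a, A a -> a < z] u Au.
rewrite /sequent; case: xgetP => [{}z _ //|/(_ z) []].
by split=> // z' /zmin.
Qed.

Definition orec (T : Type) (F : forall x : Ord, (forall y, y < x -> T) -> T) :
  Ord -> T := Fix olt_wf (fun=> T) F.

Lemma orecE T F x : @orec T F x = F x (fun y _ => orec F y).
Proof.
rewrite /orec Fix_eq // => {}x f g fg.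
by congr F; apply: functional_extensionality_dep => y;
  apply: functional_extensionality_dep => h; exact: fg.
Qed.

(** * Ordinal arithmetic (ordinary, non-commutative operations) *)

(* x + y = S({x' | x' < x} U {x + y' | y' < y}) *)
Definition oadd (x : Ord) : Ord -> Ord :=
  orec (fun y rec =>
    sequent (W x `|` [set z | exists y' (h : y' < y), z = rec y' h])).

(* x * y = S({x * y' + x' | x' < x, y' < y}) *)
Definition omul (x : Ord) : Ord -> Ord :=
  orec (fun y rec =>
    sequent [set z | exists y' (h : y' < y),
                     exists2 x', x' < x & z = oadd (rec y' h) x']).

Definition osucc (x : Ord) : Ord := sequent [set x].

Definition ofnat (n : nat) : Ord := iter n osucc ozero.

Definition omega : Ord := sequent (range ofnat).

(* omega^y = max (1, sup {omega^y' * omega | y' < y}) *)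
Definition oexpw : Ord -> Ord :=
  orec (fun y rec =>
    sequent (ozero |` [set z | exists y' (h : y' < y),
                               z < omul (rec y' h) omega])).

Lemma oaddE x y : oadd x y = sequent (W x `|` (oadd x @` W y)).
Proof.
rewrite {1}/oadd orecE; congr (sequent (_ `|` _)); apply/seteqP; split=> z /=.
  by move=> [y' [h ->]]; exists y'.
by move=> [y' h <-]; exists y', h.
Qed.

Lemma omulE x y : omul x y =
  sequent [set z | exists2 y', y' < y &
                   exists2 x', x' < x & z = oadd (omul x y') x'].
Proof.
rewrite {1}/omul orecE; congr sequent; apply/seteqP; split=> z /=.
  by move=> [y' [h H]]; exists y'.
by move=> [y' h H]; exists y', h.
Qed.

Lemma oexpwE y : oexpw y =
  sequent (ozero |` [set z | exists2 y', y' < y & z < omul (oexpw y') omega]).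
Proof.
rewrite {1}/oexpw orecE; congr (sequent (_ |` _)); apply/seteqP; split=> z /=.
  by move=> [y' [h H]]; exists y'.
by move=> [y' h H]; exists y', h.
Qed.

Lemma oexpw_gt0 y : ozero < oexpw y.
Proof.
have [u uP] := bounded_image (fun y' => omul (oexpw y') omega) y.
rewrite oexpwE; have [] := @sequentP
  (ozero |` [set z | exists2 y', y' < y & z < omul (oexpw y') omega])
  (Order.max u (osucc ozero)) _; last by move=> H _; apply: H; left.
move=> a [->|[y' /uP yu /lt_trans/(_ yu) au]]; rewrite lt_max ?au //.
apply/orP; right; have [v vP] := bounded_family (fun _ : unit => ozero).
have [] := @sequentP [set ozero] v _; first by move=> _ ->; exact: vP tt.
by move=> H _; exact: H.
Qed.

(** * Hessenberg operations *)

(* The padded Cantor normal form sum_(xi in e) omega^xi * c xi, for a list of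
   exponents [e] meant to be strictly decreasing; coefficients may vanish. *)
Definition cnf (e : seq Ord) (c : Ord -> nat) : Ord :=
  foldr (fun xi z => oadd (omul (oexpw xi) (ofnat (c xi))) z) ozero e.

(* Existence and uniqueness of Cantor normal forms make the sets below
   singletons, so that the fallback [ozero] is irrelevant. *)
Definition nsum (x y : Ord) : Ord :=
  xget ozero [set z | exists (e : seq Ord) (p q : Ord -> nat),
    [/\ sorted >%O e, x = cnf e p, y = cnf e q
      & z = cnf e (fun xi => p xi + q xi)%N]].

Definition nprod (x y : Ord) : Ord :=
  xget ozero [set z | exists (e : seq Ord) (p q : Ord -> nat),
    [/\ sorted >%O e, x = cnf e p, y = cnf e q
      & z = \big[nsum/ozero]_(xi <- e) \big[nsum/ozero]_(eta <- e)
              omul (oexpw (nsum xi eta)) (ofnat (p xi * q eta)%N)]].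

(** * The monoid W(omega^(omega^alpha)) and its Grothendieck group *)

Definition principal (alpha : Ord) : Ord := oexpw (oexpw alpha).

(* [W (principal alpha)] is a [set Ord], used as a type through the coercion
   [set_type]; [\val] is its embedding into [Ord]. *)
Notation Wp alpha := (W (principal alpha)).

Definition wzero alpha : Wp alpha :=
  exist _ ozero (mem_set (oexpw_gt0 (oexpw alpha))).

(* The initial segment W(x), for x in Wp alpha, as a set of elements of
   Wp alpha. *)
Definition below alpha (x : Wp alpha) : set (Wp alpha) :=
  [set z | \val z < \val x].

(* (a, b) ~ (c, d) iff a (+) d (+) k = c (+) b (+) k for some k. *)
Definition groth_rel alpha (u v : Wp alpha * Wp alpha) : Prop :=
  exists k : Wp alpha, nsum (nsum (\val u.1) (\val v.2)) (\val k) =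
                       nsum (nsum (\val v.1) (\val u.2)) (\val k).

(* Elements of the group are the equivalence classes of groth_rel. *)
Definition groth alpha : Type :=
  {C : set (Wp alpha * Wp alpha) | exists u, C = groth_rel u}.

(* The difference a - b in the group. *)
Definition gdiff alpha (a b : Wp alpha) : groth alpha :=
  exist _ (groth_rel (a, b)) (ex_intro _ (a, b) erefl).

Definition gembed alpha (a : Wp alpha) : groth alpha := gdiff a (wzero alpha).

(* The elements of D that are ordinals.  If a - b is an ordinal z then
   a = z (+) b >= z, so z lies in Wp alpha and it suffices to look at the
   image of gembed. *)
Definition ordinals_in alpha (D : set (groth alpha)) : set Ord :=
  [set \val z | z in @gembed alpha @^-1` D].

Definition is_natural_sum alpha (add : Wp alpha -> Wp alpha -> Wp alpha) :=
  forall x y, \val (add x y) = nsum (\val x) (\val y).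

Definition is_natural_product alpha (mul : Wp alpha -> Wp alpha -> Wp alpha) :=
  forall x y, \val (mul x y) = nprod (\val x) (\val y).

Definition rule_add alpha (add : Wp alpha -> Wp alpha -> Wp alpha) :=
  forall x y, \val (add x y) =
    sequent ([set \val (add x y') | y' in below y] `|`
             [set \val (add x' y) | x' in below x]).

Definition rule_mul alpha (gamma : Ord)
    (add mul : Wp alpha -> Wp alpha -> Wp alpha) :=
  forall x y, \val (mul x y) =
    sequent (ordinals_in [set gdiff (add (mul x' y) (mul x y')) (mul x' y')
                         | x' in below x & y' in below y]
             `&` W (osucc gamma)).

(* Main.v *)
(** Write each ordinal by its Cantor normal form coefficients: the natural sum
  adds them pointwise and the order is lexicographic from the largest exponent,
  so [z < x ⊕ y] forces [z <= x' ⊕ y] or [z <= x ⊕ y'] for some [x' < x]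
  or [y' < y].

  For the product, [x'y + xy' - x'y' = xy - (x - x')(y - y')] is less than [xy].
  For cofinality, remove one term from each factor, [x = x0 ⊕ w^a] and
  [y = y0 ⊕ w^b], and take [x' = x0 ⊕ u], [y' = y0] with [u < w^a], or
  [x' = x0], [y' = y0 ⊕ v] with [v < w^b]: the difference is then the genuine
  ordinal [x0 y0 + x0 w^b + w^a y0 + u w^b] (or [... + w^a v]), and the products
  [u w^b], [w^a v] are cofinal in [w^(a ⊕ b)].  Both rules thus determine the
  operations by well-founded recursion. *)

From HB Require Import structures.
Require Import Defs.
From mathcomp Require Import all_boot all_order.
From mathcomp Require Import boolp classical_sets.
From mathcomp Require Import zify.
Import Order.TTheory.
Local Open Scope order_scope.

Set Implicit Arguments.
Unset Strict Implicit.
Unset Printing Implicit Defensive.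

Implicit Types (x y z u : Ord) (e : seq Ord) (p q : Ord -> nat).

(** * Sequents and well-founded induction *)

Lemma lt_sequent (A : set Ord) u a :
  (forall b, A b -> b < u) -> A a -> a < sequent A.
Proof. by move=> /sequentP[H _]; exact: H. Qed.

Lemma sequent_le (A : set Ord) z : (forall a, A a -> a < z) -> sequent A <= z.
Proof. by move=> Az; have [_] := sequentP Az; exact. Qed.

Lemma lt_sequent_ex (A : set Ord) z : z < sequent A -> exists2 a, A a & z <= a.
Proof.
move=> zA; apply: contrapT => nE; suff: sequent A <= z by rewrite leNgt zA.
apply: sequent_le => a Aa; rewrite ltNge; apply/negP => za; apply: nE.
by exists a.
Qed.

Lemma bounded_image2 (f : Ord -> Ord -> Ord) x y :
  exists u, forall x' y', x' < x -> y' < y -> f x' y' < u.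
Proof.
have [g gP] := choice (fun x' => bounded_image (f x') y).
have [u uP] := bounded_image g x.
by exists u => x' y' /uP gu /gP fg; apply: lt_trans gu.
Qed.

Lemma olt_ind (P : Ord -> Prop) :
  (forall x, (forall y, y < x -> P y) -> P x) -> forall x, P x.
Proof. by move=> H x; elim: (olt_wf x) => y _; exact: H. Qed.

(** If [f x < x], monotonicity gives [f (f x) < f x], against the induction hypothesis at [f x]. *)
Lemma le_homo_self (f : Ord -> Ord) x : {homo f : y z / y < z} -> x <= f x.
Proof.
move=> fh; elim/olt_ind: x => x IH; rewrite leNgt; apply/negP => /[dup] fx /fh.
by rewrite ltNge IH.
Qed.

(** * Ordinary ordinal addition and multiplication *)

Lemma oadd_bounded x y :
  exists u, forall a, (W x `|` (oadd x @` W y))%classic a -> a < u.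
Proof.
have [u uP] := bounded_image (oadd x) y.
exists (Order.max x u) => a [ax|[y' /uP y'u <-]]; rewrite lt_max.
  by rewrite [a < x]ax.
by rewrite y'u orbT.
Qed.

Lemma ltr_oadd x y z : y < z -> oadd x y < oadd x z.
Proof.
move=> yz; rewrite [ltRHS]oaddE; have [u uP] := oadd_bounded x z.
by apply: lt_sequent uP _; right; exists y.
Qed.

Lemma lt_oadd_base x y z : z < x -> z < oadd x y.
Proof.
move=> zx; rewrite oaddE; have [u uP] := oadd_bounded x y.
by apply: lt_sequent uP _; left.
Qed.

Lemma le_oadd x y : x <= oadd x y.
Proof. by rewrite leNgt; apply/negP => /lt_oadd_base - /(_ y); rewrite ltxx. Qed.

Lemma lt_oadd_ex x y z : z < oadd x y ->
  z < x \/ exists2 y', y' < y & z <= oadd x y'.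
Proof.
rewrite oaddE => /lt_sequent_ex[a [ax|[y' yy' <-]] za].
  by left; apply: le_lt_trans ax.
by right; exists y'.
Qed.

Lemma lt0F z : (z < ozero) = false.
Proof. by apply/negbTE; rewrite -leNgt ole0. Qed.

Lemma lt0x z : (ozero < z) = (z != ozero).
Proof. by rewrite lt_neqAle ole0 andbT eq_sym. Qed.

Lemma oaddx0 x : oadd x ozero = x.
Proof.
apply/le_anti; rewrite le_oadd andbT leNgt; apply/negP => /lt_oadd_ex.
by rewrite ltxx => -[//|[y]]; rewrite lt0F.
Qed.

Lemma oadd0x x : oadd ozero x = x.
Proof.
elim/olt_ind: x => x IH; apply/le_anti/andP; split; rewrite leNgt; apply/negP.
  move=> /lt_oadd_ex; rewrite lt0F => -[//|[y' yx]].
  by rewrite IH // leNgt yx.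
by move=> /[dup] + /IH => /(ltr_oadd ozero) /[swap] ->; rewrite ltxx.
Qed.

Lemma oadd_sub x z : x <= z -> exists y, z = oadd x y.
Proof.
move=> xz; have zx : z <= oadd x z by apply: le_homo_self => ? ?; apply: ltr_oadd.
(* The difference is the least [y] with [z <= oadd x y]; a strict inequality would produce a smaller
   one. *)
have [y zy ymin] := @olt_least [set y | z <= oadd x y]%classic z zx.
exists y; apply/le_anti; rewrite [X in X && _]zy leNgt; apply/negP.
move=> /lt_oadd_ex[|[y' yy' /ymin]]; first by rewrite ltNge xz.
by rewrite leNgt yy'.
Qed.

Lemma omul_bounded x y : exists u, forall a,
  (exists2 y', y' < y & exists2 x', x' < x & a = oadd (omul x y') x') -> a < u.
Proof.
have [u uP] := bounded_image2 (fun y' x' => oadd (omul x y') x') y x.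
by exists u => a [y' yy' [x' xx' ->]]; apply: uP.
Qed.

Lemma lt_omul x y y' x' : y' < y -> x' < x -> oadd (omul x y') x' < omul x y.
Proof.
move=> yy' xx'; have [u uP] := omul_bounded x y; rewrite [ltRHS]omulE.
by apply: lt_sequent uP _; exists y' => //; exists x'.
Qed.

Lemma lt_omul_ex x y z : z < omul x y ->
  exists2 y', y' < y & exists2 x', x' < x & z <= oadd (omul x y') x'.
Proof.
rewrite omulE => /lt_sequent_ex[a [y' yy' [x' xx' ->]] za].
by exists y' => //; exists x'.
Qed.

Lemma omulx0 x : omul x ozero = ozero.
Proof.
apply/eqP; rewrite -[_ == _]negbK -lt0x; apply/negP => /lt_omul_ex[y].
by rewrite lt0F.
Qed.

Lemma lt_osucc x y : (x < osucc y) = (x <= y).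
Proof.
have [u uP] := bounded_family (fun _ : unit => y).
apply/idP/idP => [/lt_sequent_ex[a -> //]|xy]; apply: le_lt_trans xy _.
by apply: (@lt_sequent _ u) => // _ ->; exact: uP tt.
Qed.

Lemma ofnat_lt_omega n : ofnat n < omega.
Proof.
have [u uP] := bounded_family ofnat.
by apply: (@lt_sequent _ u) => [_ [m _ <-]|]; [exact: uP | exists n].
Qed.

Lemma lt_ofnat m n : (m < n)%N -> ofnat m < ofnat n.
Proof.
elim: n => // n IH; rewrite ltnS leq_eqVlt => /predU1P[->|/IH mn].
  by rewrite /= lt_osucc.
by rewrite /= lt_osucc ltW.
Qed.

Lemma lt_ofnat_ex z n : z < ofnat n -> exists2 m, (m < n)%N & z = ofnat m.
Proof.
elim: n => [|n IH]; first by rewrite lt0F.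
rewrite /= lt_osucc le_eqVlt => /predU1P[->|/IH[m mn ->]]; first by exists n.
by exists m => //; apply: ltnW.
Qed.

Lemma lt_omega_ex z : z < omega -> exists n, z = ofnat n.
Proof.
move=> /lt_sequent_ex[_ [n _ <-]]; rewrite le_eqVlt => /predU1P[->|].
  by exists n.
by move=> /lt_ofnat_ex[m _ ->]; exists m.
Qed.

(** * Monomials and powers of omega *)

Definition omono (a : Ord) (n : nat) : Ord := omul (oexpw a) (ofnat n).

Lemma mono0 a : omono a 0 = ozero. Proof. exact: omulx0. Qed.

Lemma oexpw_bounded y : exists u, forall a,
  (ozero |` [set z | exists2 y', y' < y & z < omul (oexpw y') omega])%classic a ->
  a < u.
Proof.
have [u uP] := bounded_image (fun y' => omul (oexpw y') omega) y.
exists (Order.max (osucc ozero) u) => a [->|[y' /uP yu /lt_trans/(_ yu) au]].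
  by rewrite lt_max lt_osucc lexx.
by rewrite lt_max au orbT.
Qed.

Lemma lt_oexpw_mul y y' z : y' < y -> z < omul (oexpw y') omega -> z < oexpw y.
Proof.
move=> yy' zy; rewrite oexpwE; have [u uP] := oexpw_bounded y.
by apply: lt_sequent uP _; right; exists y'.
Qed.

Lemma lt_oexpw_ex y z : z < oexpw y ->
  z = ozero \/ exists2 y', y' < y & z < omul (oexpw y') omega.
Proof.
rewrite oexpwE => /lt_sequent_ex[a [->|[y' yy' ay]] za].
  by left; apply/le_anti; rewrite za ole0.
by right; exists y' => //; apply: le_lt_trans ay.
Qed.

Lemma lt_mono_omega a n r : r < oexpw a ->
  oadd (omono a n) r < omul (oexpw a) omega.
Proof. by apply: lt_omul; apply: ofnat_lt_omega. Qed.

Lemma mono1 a : omono a 1 = oexpw a.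
Proof.
have H x' : x' < oexpw a -> x' < omono a 1.
  move=> xa; have := @lt_omul (oexpw a) (ofnat 1) ozero x' _ xa.
  by rewrite omulx0 oadd0x; apply; exact: (@lt_ofnat 0).
apply/le_anti/andP; split; rewrite leNgt; apply/negP; last first.
  by move=> /H; rewrite ltxx.
move=> /lt_omul_ex[y' /(@lt_ofnat_ex _ 1)[[|//] _ ->] [x' xa]].
by rewrite omulx0 oadd0x leNgt xa.
Qed.

Lemma lt_oexpw x y : x < y -> oexpw x < oexpw y.
Proof.
move=> xy; apply: lt_oexpw_mul xy _.
by have := lt_mono_omega 1 (oexpw_gt0 x); rewrite oaddx0 mono1.
Qed.

Lemma lt_oexpwE x y : (oexpw x < oexpw y) = (x < y).
Proof.
apply/idP/idP; last exact: lt_oexpw.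
by case: (ltgtP x y) => // [/lt_oexpw/lt_gtF ->|->]; rewrite ?ltxx.
Qed.

(** Division with remainder by [oexpw a], by induction on the [n] of a bound
    [z <= oadd (omono a n) r]. Either the monomial of this bound can be subtracted from [z], or [z]
    satisfies such a bound with the preceding [n]. *)
Lemma lt_omega_div a z : z < omul (oexpw a) omega ->
  exists n r, r < oexpw a /\ z = oadd (omono a n) r.
Proof.
move=> /lt_omul_ex[_ /lt_omega_ex[n ->] []].
elim: n => [|n IH] r ra zr.
  exists 0%N, z; rewrite mono0 oadd0x; split=> //.
  by move: zr; rewrite omulx0 oadd0x => /le_lt_trans; apply.
have [/oadd_sub[s zs]|] := leP (omono a n.+1) z.
  exists n.+1, s; split=> //; rewrite ltNge; apply/negP => sa.
  by move: zr; rewrite zs leNgt ltr_oadd // (lt_le_trans ra).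
move=> /lt_omul_ex[_ /lt_ofnat_ex[m mn ->] [s sa zs]].
apply: (IH s) => //; move: mn; rewrite ltnS leq_eqVlt => /predU1P[<- //|mn].
apply: le_trans zs _; apply: le_trans _ (le_oadd _ _).
by apply/ltW/lt_omul => //; apply: lt_ofnat.
Qed.

(** * Cantor normal forms: comparison, existence, uniqueness *)

Lemma ogt_trans : transitive (>%O : rel Ord).
Proof. by move=> y x z /= xy yz; apply: lt_trans xy. Qed.

Lemma cnf_lt e p a : sorted >%O e -> (forall b, b \in e -> b < a) ->
  cnf e p < oexpw a.
Proof.
elim: e a => [|b e IH] a /= => [_ _|se ea]; first exact: oexpw_gt0.
apply: (@lt_oexpw_mul _ b); first by apply: ea; rewrite mem_head.
apply: lt_mono_omega; apply: IH (path_sorted se) _ => c ce.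
by move: se; rewrite (path_sortedE ogt_trans) => /andP[/allP/(_ _ ce)].
Qed.

Lemma sorted_gt_cons a e : sorted >%O (a :: e) ->
  sorted >%O e /\ forall b, b \in e -> b < a.
Proof.
by rewrite /= (path_sortedE ogt_trans) => /andP[/allP ? ?]; split.
Qed.

(** At the first difference, one more copy of [oexpw c] outweighs the whole remaining tail, which is
    below [oexpw c] by [cnf_lt]. *)
Lemma cnf_lex e p q : sorted >%O e ->
  (exists2 a, a \in e & (p a < q a)%N /\ forall b, b \in e -> a < b -> p b = q b) ->
  cnf e p < cnf e q.
Proof.
elim: e => [|c e IH] se [a]; rewrite ?in_nil //.
have [se' ec] := sorted_gt_cons se.
rewrite inE => /predU1P[->{a} [pq _]|ae [pq H]] /=.
  apply: (@lt_le_trans _ _ (omono c (q c))); last exact: le_oadd.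
  by apply: lt_omul (lt_ofnat pq) _; apply: cnf_lt.
rewrite H ?mem_head ?ec //; apply: ltr_oadd; apply: IH => //.
by exists a => //; split=> // b be; apply: H; rewrite inE be orbT.
Qed.

Lemma eq_in_cnf e p q : {in e, p =1 q} -> cnf e p = cnf e q.
Proof.
elim: e => //= a e IH pq; rewrite pq ?mem_head // IH // => b be.
by apply: pq; rewrite inE be orbT.
Qed.

Lemma cnf_filter e (P : pred Ord) p :
  cnf e (fun a => if P a then p a else 0%N) = cnf (filter P e) p.
Proof.
elim: e => //= a e ->; case: (P a) => //=.
by rewrite -/(omono a 0) mono0 oadd0x.
Qed.

Lemma cnf_pad e e' p : sorted >%O e -> sorted >%O e' -> {subset e <= e'} ->
  cnf e p = cnf e' (fun a => if a \in e then p a else 0%N).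
Proof.
move=> se se' ee'; rewrite (cnf_filter e' (mem e)); congr cnf.
apply: (irr_sorted_eq ogt_trans (ltxx)) => //.
  exact: (sorted_filter ogt_trans).
by move=> a; rewrite mem_filter; apply/idP/andP => [ae|[]//]; split; rewrite ?ee'.
Qed.

(** The last clause strengthens the induction: for an exponent [b] of the remainder [r] it gives
    [oexpw b <= r < oexpw a], hence [b < a], so the list stays strictly decreasing when [a] is put
    in front. *)
Lemma cnf_exists x : exists e p, [/\ sorted >%O e, x = cnf e p &
  forall a, a \in e -> oexpw a <= x].
Proof.
elim/olt_ind: x => x IH.
have [->|x0] := eqVneq x ozero; first by exists [::], (fun=> 0%N).
have xo : x < oexpw (osucc x).
  apply: le_lt_trans (le_homo_self x lt_oexpw) _.
  by apply: lt_oexpw; rewrite lt_osucc.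
(* By minimality of [c], the [a < c] with [x] below [oexpw a] times [omega] also has [oexpw a <= x]:
   it is the leading exponent. *)
have [c xc cmin] := @olt_least [set c | x < oexpw c]%classic _ xo.
have [E|[a ac /lt_omega_div[n [r [ra xE]]]]] := lt_oexpw_ex xc.
  by rewrite E eqxx in x0.
have ax : oexpw a <= x.
  by rewrite leNgt; apply/negP => /cmin; rewrite leNgt ac.
have rx := lt_le_trans ra ax.
have [e [p [se rE er]]] := IH _ rx.
have ea b : b \in e -> b < a.
  by move=> /er br; rewrite -lt_oexpwE; apply: le_lt_trans ra.
exists (a :: e), (fun b => if b == a then n else p b); split.
- rewrite /= (path_sortedE ogt_trans) se andbT; exact/allP.
- rewrite /= eqxx xE rE; congr oadd; apply: eq_in_cnf => b /ea.
  by rewrite lt_neqAle => /andP[/negbTE ->].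
- move=> b; rewrite inE => /predU1P[-> //|/er br].
  exact/ltW/(le_lt_trans br).
Qed.

Lemma first_diff e p q : sorted >%O e -> {in e, p =1 q} \/
  exists2 a, a \in e & p a != q a /\ forall b, b \in e -> a < b -> p b = q b.
Proof.
elim: e => [|c e IH] se; first by left.
have [se' ec] := sorted_gt_cons se.
have [E|N] := eqVneq (p c) (q c); last first.
  right; exists c; rewrite ?mem_head //; split=> // b.
  by rewrite inE => /predU1P[->|/ec/lt_gtF ->]; rewrite ?ltxx.
have [H|[a ae [N H]]] := IH se'.
  by left=> b; rewrite inE => /predU1P[->|/H].
right; exists a; rewrite ?inE ?ae ?orbT //; split=> // b.
by rewrite inE => /predU1P[->|/H].
Qed.

Lemma cnf_inj e p q : sorted >%O e -> cnf e p = cnf e q -> {in e, p =1 q}.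
Proof.
move=> se E; have [//|[a ae [N H]]] := first_diff p q se.
move: N; rewrite neq_ltn => /orP[] N.
  suff: cnf e p < cnf e q by rewrite E ltxx.
  by apply: cnf_lex => //; exists a.
suff: cnf e q < cnf e p by rewrite E ltxx.
by apply: cnf_lex => //; exists a => //; split=> // b be ab; rewrite H.
Qed.

(** * Common exponent lists and coefficient functions *)

Definition join e e' : seq Ord := rev (sort <=%O (undup (e ++ e'))).

Lemma mem_join e e' a : (a \in join e e') = (a \in e) || (a \in e').
Proof. by rewrite mem_rev mem_sort mem_undup mem_cat. Qed.

Lemma sorted_join e e' : sorted >%O (join e e').
Proof.
by rewrite rev_sorted -[sorted _ _]/(sorted <%O _) sort_lt_sorted undup_uniq.
Qed.

Lemma sub_joinl e e' : {subset e <= join e e'}.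
Proof. by move=> a ae; rewrite mem_join ae. Qed.

Lemma sub_joinr e e' : {subset e' <= join e e'}.
Proof. by move=> a ae; rewrite mem_join ae orbT. Qed.


(** Normalisation of the padded form: exponents with zero coefficient are dropped and the
    coefficients are set to zero off the list. The coefficients then become a total function on
    [Ord] that depends on [x] only. *)
Lemma coef_exists x : exists es : seq Ord * (Ord -> nat),
  [/\ sorted >%O es.1, x = cnf es.1 es.2 & forall a, (a \in es.1) = (es.2 a != 0)%N].
Proof.
have [e [p [se -> _]]] := cnf_exists x.
exists (filter (fun a => p a != 0%N) e, fun a => if a \in e then p a else 0%N).
split=> /= [||a]; first exact: (sorted_filter ogt_trans).
  rewrite -cnf_filter; apply: eq_in_cnf => a ae; rewrite ae.
  by case: eqP => // ->.
by rewrite mem_filter; case: (a \in e); rewrite ?andbT ?andbF.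
Qed.

Definition expos x : seq Ord := (sval (cid (coef_exists x))).1.
Definition coef x : Ord -> nat := (sval (cid (coef_exists x))).2.

Lemma coefP x : [/\ sorted >%O (expos x), x = cnf (expos x) (coef x)
  & forall a, (a \in expos x) = (coef x a != 0)%N].
Proof. exact: (svalP (cid (coef_exists x))). Qed.

Lemma cnf_coef x e : sorted >%O e -> {subset expos x <= e} ->
  x = cnf e (coef x).
Proof.
have [sx xE xP] := coefP x => se xe; rewrite {1}xE (cnf_pad _ sx se xe).
by apply: eq_in_cnf => a _; rewrite xP; case: eqP => [->|].
Qed.

Lemma coef_cnf e p a : sorted >%O e ->
  coef (cnf e p) a = if a \in e then p a else 0%N.
Proof.
move=> se; set x := cnf e p; have [sx _ xP] := coefP x.
pose e' := join (expos x) e; have se' : sorted >%O e' by exact: sorted_join.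
have : cnf e' (coef x) = cnf e' (fun a => if a \in e then p a else 0%N).
  by rewrite -cnf_coef // -?cnf_pad //; [exact: sub_joinr | exact: sub_joinl].
move=> /(cnf_inj se') H; have [/H //|] := boolP (a \in e').
by rewrite mem_join xP negb_or negbK => /andP[/eqP -> /negbTE ->].
Qed.

Lemma coef_inj x y : coef x =1 coef y -> x = y.
Proof.
move=> xy; have sj := sorted_join (expos x) (expos y).
rewrite [x](cnf_coef sj (@sub_joinl _ _)).
by rewrite [RHS](cnf_coef sj (@sub_joinr _ _)); apply: eq_in_cnf => a _.
Qed.

(** Any padded representation picked by [xget] gives these coefficients, and the joined exponent
    list shows that one exists, so the default value never occurs. *)
Lemma coef_nsum x y a : coef (nsum x y) a = (coef x a + coef y a)%N.
Proof.
rewrite /nsum; case: xgetP => [_ -> [e [p [q [se -> -> ->]]]]|none].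
  by rewrite !coef_cnf //; case: ifP.
have sj := sorted_join (expos x) (expos y); exfalso; apply: none.
exists (join (expos x) (expos y)), (coef x), (coef y); split=> //.
  exact: cnf_coef sj (@sub_joinl _ _).
exact: cnf_coef sj (@sub_joinr _ _).
Qed.

(** The lexicographic order freed from exponent lists: both ordinals are padded to a joined list,
    outside which all coefficients vanish. *)
Lemma lt_coefP x y : x < y <->
  exists2 a, (coef x a < coef y a)%N & forall b, a < b -> coef x b = coef y b.
Proof.
have sj := sorted_join (expos x) (expos y); set e := join _ _ in sj.
have xe : {subset expos x <= e} by exact: sub_joinl.
have ye : {subset expos y <= e} by exact: sub_joinr.
have [_ _ xP] := coefP x; have [_ _ yP] := coefP y.
have notin a : a \notin e -> coef x a = 0%N /\ coef y a = 0%N.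
  by rewrite mem_join xP yP negb_or !negbK => /andP[/eqP -> /eqP ->].
have lt p q : (exists2 a, (p a < q a)%N & forall b, a < b -> p b = q b) ->
    (forall a, a \notin e -> q a = 0%N) -> cnf e p < cnf e q.
  move=> [a pq H] q0; apply: cnf_lex => //; exists a.
    by apply: contraLR pq => /q0 ->.
  by split=> // b _; exact: H.
split=> [xy|H]; last first.
  by rewrite (cnf_coef sj xe) (cnf_coef sj ye); apply: lt => // a /notin[].
have [H|[a ae [N H]]] := first_diff (coef x) (coef y) sj.
  move: xy; rewrite (cnf_coef sj xe) (cnf_coef sj ye) (eq_in_cnf H).
  by rewrite ltxx.
have {}H b : a < b -> coef x b = coef y b.
  by have [/H //|/notin[-> ->]] := boolP (b \in e).
move: N; rewrite neq_ltn => /orP[] N; first by exists a.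
suff: y < x by move=> /(lt_trans xy); rewrite ltxx.
rewrite (cnf_coef sj xe) (cnf_coef sj ye); apply: lt => [|b /notin[]//].
by exists a => // b /H.
Qed.

Lemma coef0 a : coef ozero a = 0%N.
Proof. exact: (@coef_cnf [::] (fun=> 0%N)). Qed.

Lemma coef_mono a n b : coef (omono a n) b = if b == a then n else 0%N.
Proof.
by have := @coef_cnf [:: a] (fun=> n) b isT; rewrite /= oaddx0 inE.
Qed.

Lemma coef_oexpw a b : coef (oexpw a) b = (b == a) :> nat.
Proof. by rewrite -mono1 coef_mono; case: eqP. Qed.

(** * The natural sum: monoid laws, order and cancellation *)

Lemma nsumC : commutative nsum.
Proof. by move=> x y; apply: coef_inj => a; rewrite !coef_nsum addnC. Qed.

Lemma nsumA : associative nsum.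
Proof. by move=> x y z; apply: coef_inj => a; rewrite !coef_nsum addnA. Qed.

Lemma nsum0x : left_id ozero nsum.
Proof. by move=> x; apply: coef_inj => a; rewrite coef_nsum coef0. Qed.

HB.instance Definition _ := Monoid.isComLaw.Build Ord ozero nsum nsumA nsumC nsum0x.

Local Notation "x ⊕ y" := (nsum x y) (at level 50, left associativity).
Local Notation "x ⊗ y" := (nprod x y) (at level 40, left associativity).

Lemma nsumx0 : right_id ozero nsum. Proof. exact: Monoid.mulm1. Qed.

Lemma nsumAC x y z : x ⊕ y ⊕ z = x ⊕ z ⊕ y. Proof. exact: Monoid.mulmAC. Qed.

Lemma lt_nsum2l z x y : (z ⊕ x < z ⊕ y) = (x < y).
Proof.
by apply/idP/idP => /lt_coefP[a xy H]; apply/lt_coefP; exists a;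
  [move: xy | move=> b /H | | move=> b /H];
  rewrite !coef_nsum ?ltn_add2l //; [exact: addnI | move=> ->].
Qed.

Lemma lt_nsum2r z x y : (x ⊕ z < y ⊕ z) = (x < y).
Proof. by rewrite ![_ ⊕ z]nsumC lt_nsum2l. Qed.

Lemma le_nsum2l z x y : (z ⊕ x <= z ⊕ y) = (x <= y).
Proof. by rewrite !leNgt lt_nsum2l. Qed.

Lemma le_nsum2r z x y : (x ⊕ z <= y ⊕ z) = (x <= y).
Proof. by rewrite !leNgt lt_nsum2r. Qed.

Lemma nsumI z : injective (nsum z).
Proof.
move=> x y E; apply/le_anti.
by rewrite -(le_nsum2l z x) -(le_nsum2l z y) E lexx.
Qed.

Lemma nsumIr z : injective (nsum^~ z).
Proof. by move=> x y /=; rewrite ![_ ⊕ z]nsumC => /nsumI. Qed.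

Lemma lt_le_nsum x y z t : x < y -> z <= t -> x ⊕ z < y ⊕ t.
Proof. by rewrite -(lt_nsum2r z x) -(le_nsum2l y z) => /lt_le_trans; apply. Qed.

Lemma le_nsumr x y : y <= x ⊕ y.
Proof. by rewrite -{1}[y]nsum0x le_nsum2r ole0. Qed.

Lemma le_nsuml x y : x <= x ⊕ y.
Proof. by rewrite nsumC le_nsumr. Qed.

(** * Ordinals below a natural sum *)

Lemma coef_supp p e : (forall a, p a != 0%N -> a \in e) -> exists x, coef x =1 p.
Proof.
move=> pe; have se := sorted_join e [::].
exists (cnf (join e [::]) p) => a; rewrite coef_cnf // mem_join orbF.
by case: ifP => // ae; apply/esym/eqP; apply: contraFT ae; apply: pe.
Qed.

Lemma coef_split x a : (0 < coef x a)%N -> exists x0, x = x0 ⊕ oexpw a.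
Proof.
move=> xa; have [_ _ xP] := coefP x.
have [b bx|x0 x0E] := @coef_supp (fun b => coef x b - (b == a))%N (expos x).
  by rewrite xP; apply: contraNneq bx => ->.
exists x0; apply: coef_inj => b; rewrite coef_nsum x0E coef_oexpw subnK //.
by case: eqP => // ->.
Qed.

(** Let [a] be the greatest exponent where [z] and [x ⊕ y] differ. One summand has a positive
    coefficient there; lowering it by one leaves room to put anything at smaller exponents. *)
Lemma lt_nsum_split x y z : z < x ⊕ y ->
  (exists2 x', x' < x & z <= x' ⊕ y) \/ (exists2 y', y' < y & z <= x ⊕ y').
Proof.
suff H u v : z < u ⊕ v -> (exists a, [/\ (coef z a < coef u a + coef v a)%N,
    forall b, a < b -> coef z b = (coef u b + coef v b)%N & (0 < coef v a)%N]) ->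
    exists2 y', y' < v & z <= u ⊕ y'.
  move=> /[dup] zxy /lt_coefP[a]; rewrite coef_nsum => lt_a eq_xy.
  have eq_a b : a < b -> coef z b = (coef x b + coef y b)%N.
    by move=> /eq_xy; rewrite coef_nsum.
  have [va|] := ltnP 0 (coef y a).
    by right; apply: H => //; exists a.
  rewrite leqn0 => /eqP va0; left; have [||x' x'x zx'] := H y x.
  - by rewrite nsumC.
  - exists a; split=> [|b /eq_a ->|]; rewrite 1?addnC //.
    by move: lt_a; rewrite va0 addn0; case: (coef x a).
  - by exists x' => //; rewrite nsumC.
move=> _ [a [lt_a eq_a va]]; have [_ _ vP] := coefP v; have [_ _ zP] := coefP z.
(* Below [a] the coefficients of [z] are copied, so that [u ⊕ v'] dominates [z] at every exponent up
   to [a]. *)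
pose r b := if a < b then coef v b else if b == a then (coef v a).-1 else coef z b.
have [b|v' v'E] := @coef_supp r (join (expos v) (expos z)).
  rewrite mem_join vP zP /r; case: ifP => [_ ->//|_].
  by have [-> _|_ ->] := eqVneq b a; rewrite ?orbT // -lt0n va.
exists v'.
  apply/lt_coefP; exists a => [|b ab]; rewrite v'E /r ?ltxx ?ab // eqxx.
  by rewrite prednK.
rewrite leNgt; apply/negP => /lt_coefP[b]; rewrite coef_nsum v'E => lt_b eq_b.
have [ab|ba|E] := ltgtP a b; last subst b.
- by move: lt_b; rewrite /r ab eq_a // ltnn.
- move: lt_b; rewrite /r lt_gtF // lt_eqF //.
  by rewrite -{2}[coef z b]add0n ltn_add2r.
- move: lt_b lt_a; rewrite /r eqxx ltxx; case: (coef v a) va => // n _.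
  by move=> /= lt_b; rewrite addnS ltnS leqNgt lt_b.
Qed.

Ltac nsum_ac := by apply: coef_inj => ?; rewrite !coef_nsum; lia.

(** Every nonzero ordinal is [x0 ⊕ oexpw a] with [x0] strictly smaller, so terms can be removed one
    at a time. *)
Lemma oexpw_ind (P : Ord -> Prop) : P ozero ->
  (forall x a, P x -> P (x ⊕ oexpw a)) -> forall x, P x.
Proof.
move=> P0 PS; elim/olt_ind => x IH.
have [[a xa]|nE] := pselect (exists a, (0 < coef x a)%N).
  have [x0 xE] := coef_split xa; rewrite xE; apply/PS/IH.
  by rewrite xE -{1}[x0]nsumx0 lt_nsum2l oexpw_gt0.
suff -> : x = ozero by [].
apply: coef_inj => a; rewrite coef0; apply/eqP; rewrite -leqn0 leqNgt.
by apply/negP => xa; apply: nE; exists a.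
Qed.

Lemma lt_oexpwP x a : x < oexpw a <-> forall b, coef x b != 0%N -> b < a.
Proof.
split=> [/lt_coefP[c] | H].
  rewrite coef_oexpw; case: eqP => // -> xa H b; apply: contraNT.
  rewrite -leNgt le_eqVlt => /predU1P[<-|]; first by rewrite -leqn0; exact: xa.
  by move=> /[dup] ab /H ->; rewrite coef_oexpw (gt_eqF ab).
have x0 b : a <= b -> coef x b = 0%N.
  by move=> ab; apply/eqP; apply: contraTT ab => /H; rewrite ltNge.
apply/lt_coefP; exists a; first by rewrite x0 ?coef_oexpw ?eqxx.
by move=> b ab; rewrite x0 ?coef_oexpw ?gt_eqF // ltW.
Qed.

Lemma nsum_lt_oexpw x y a : x < oexpw a -> y < oexpw a -> x ⊕ y < oexpw a.
Proof.
move=> /lt_oexpwP xa /lt_oexpwP ya; apply/lt_oexpwP => b.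
by rewrite coef_nsum addn_eq0 negb_and => /orP[/xa|/ya].
Qed.

Lemma lt_oexpw_split x z : z < x -> exists x0 a w,
  [/\ x = x0 ⊕ oexpw a, w < oexpw a & z <= x0 ⊕ w].
Proof.
elim/oexpw_ind: x z => [|x a IH] z; first by rewrite lt0F.
move=> /lt_nsum_split[[x' /IH[x0 [b [w [-> wb xw]]]] zx]|[w wa zw]].
  exists (x0 ⊕ oexpw a), b, w; split=> //; first by rewrite nsumAC.
  by rewrite nsumAC; apply: le_trans zx _; rewrite le_nsum2r.
by exists x, a, w.
Qed.

(** * The natural product: bilinearity and powers of omega *)

Lemma big_expos e x (F : Ord -> Ord) : uniq e -> {subset expos x <= e} ->
  (forall a, coef x a = 0%N -> F a = ozero) ->
  \big[nsum/ozero]_(a <- e) F a = \big[nsum/ozero]_(a <- expos x) F a.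
Proof.
have [sx _ xP] := coefP x => ue xe F0.
rewrite (bigID (mem (expos x))) /= [X in _ ⊕ X]big1 => [|a]; last first.
  by rewrite xP negbK => /eqP /F0.
rewrite nsumx0 -big_filter; apply/perm_big/uniq_perm.
- exact: filter_uniq.
- exact: (sorted_uniq ogt_trans ltxx).
- move=> a; rewrite mem_filter; apply/andP/idP => [[]//|ax].
  by split=> //; apply: xe.
Qed.

(** Padding adds only zero terms, so the double sum does not depend on the lists. Each factor may
    thus have its own list, which is what distributivity uses. *)
Lemma nprodE e e' x y : uniq e -> uniq e' ->
  {subset expos x <= e} -> {subset expos y <= e'} ->
  x ⊗ y = \big[nsum/ozero]_(a <- e) \big[nsum/ozero]_(b <- e')
              omono (a ⊕ b) (coef x a * coef y b).
Proof.
pose S f f' := \big[nsum/ozero]_(a <- f) \big[nsum/ozero]_(b <- f')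
              omono (a ⊕ b) (coef x a * coef y b).
have SE f f' : uniq f -> uniq f' -> {subset expos x <= f} ->
    {subset expos y <= f'} -> S f f' = S (expos x) (expos y).
  move=> uf uf' xf yf'; rewrite /S (big_expos uf xf) => [|a a0].
    apply: eq_bigr => a _; apply: big_expos => // b b0.
    by rewrite b0 muln0 mono0.
  by apply: big1 => b _; rewrite a0 mul0n mono0.
move=> ue ue' xe ye'; rewrite -/(S e e') SE // /nprod.
case: xgetP => [_ -> [f [p [q [sf xE yE ->]]]]|none].
  have uf : uniq f := sorted_uniq ogt_trans ltxx sf.
  rewrite -(SE f f) //; first last.
  - move=> a; have [_ _ ->] := coefP y; rewrite yE coef_cnf //.
    by case: ifP => // _; rewrite eqxx.
  - move=> a; have [_ _ ->] := coefP x; rewrite xE coef_cnf //.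
    by case: ifP => // _; rewrite eqxx.
  apply: eq_big_seq => a af; apply: eq_big_seq => b bf.
  by rewrite xE yE !coef_cnf // af bf.
exfalso; have sj := sorted_join (expos x) (expos y); apply: none.
exists (join (expos x) (expos y)), (coef x), (coef y); split=> //.
  exact: cnf_coef sj (@sub_joinl _ _).
exact: cnf_coef sj (@sub_joinr _ _).
Qed.

Lemma uniq_join e e' : uniq (join e e').
Proof. exact: (sorted_uniq ogt_trans ltxx (sorted_join e e')). Qed.

Lemma expos_uniq x : uniq (expos x).
Proof. by have [/(sorted_uniq ogt_trans ltxx)] := coefP x. Qed.

Lemma nprodC : commutative nprod.
Proof.
move=> x y; have [ux uy] := (expos_uniq x, expos_uniq y).
rewrite (nprodE ux uy) // (nprodE uy ux) // exchange_big.
by apply: eq_bigr => a _; apply: eq_bigr => b _; rewrite mulnC nsumC.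
Qed.

Lemma monoD a m n : omono a (m + n) = omono a m ⊕ omono a n.
Proof.
by apply: coef_inj => b; rewrite coef_nsum !coef_mono; case: eqP.
Qed.

Lemma nprodDl : left_distributive nprod nsum.
Proof.
move=> x y z; have uj := uniq_join (expos x) (expos y).
have uz := expos_uniq z.
rewrite (nprodE uj uz) //; last first.
  move=> a; have [_ _ ->] := coefP (x ⊕ y); rewrite coef_nsum mem_join.
  have [_ _ ->] := coefP x; have [_ _ ->] := coefP y.
  by rewrite addn_eq0 negb_and.
rewrite (nprodE uj uz (@sub_joinl _ _)) // (nprodE uj uz (@sub_joinr _ _)) //.
rewrite -big_split; apply: eq_bigr => a _; rewrite -big_split.
by apply: eq_bigr => b _; rewrite coef_nsum mulnDl monoD.
Qed.

Lemma nprodDr : right_distributive nprod nsum.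
Proof. by move=> x y z; rewrite ![x ⊗ _]nprodC nprodDl. Qed.

Lemma nprod_mono a b m n : omono a m ⊗ omono b n = omono (a ⊕ b) (m * n).
Proof.
have sub c k : {subset expos (omono c k) <= [:: c]}.
  move=> d; have [_ _ ->] := coefP (omono c k); rewrite coef_mono inE.
  by case: (d =P c).
by rewrite (nprodE _ _ (sub a m) (sub b n)) // !big_seq1 !coef_mono !eqxx.
Qed.

Lemma nprod_oexpw a b : oexpw a ⊗ oexpw b = oexpw (a ⊕ b).
Proof. by rewrite -!mono1 nprod_mono. Qed.

Lemma nprod0x x : ozero ⊗ x = ozero.
Proof. by apply: (@nsumI (ozero ⊗ x)); rewrite -nprodDl !nsumx0. Qed.

(** Each term [oexpw c] of [w] has [c < a] and contributes [oexpw (c ⊕ b)]; ordinals below a power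
    of omega are closed under [⊕]. *)
Lemma nprod_lt_oexpw w a b : w < oexpw a -> w ⊗ oexpw b < oexpw (a ⊕ b).
Proof.
elim/oexpw_ind: w => [|w c IH] wa; first by rewrite nprod0x oexpw_gt0.
rewrite nprodDl nprod_oexpw nsum_lt_oexpw //.
  exact/IH/(le_lt_trans _ wa)/le_nsuml.
by rewrite lt_oexpwE lt_nsum2r -lt_oexpwE (le_lt_trans _ wa) ?le_nsumr.
Qed.

(** * The strict cross inequality for products *)

Lemma lt_nsum_ind (P : Ord -> Ord -> Prop) :
  (forall x y z, P x y -> P y z -> P x z) ->
  (forall z w a, w < oexpw a -> P (z ⊕ w) (z ⊕ oexpw a)) ->
  forall x y, x < y -> P x y.
Proof.
move=> Ptrans Pstep x y; elim/olt_ind: y x => y IH x.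
(* Lowering a single term of [y] reaches some [z ⊕ w] with [x <= z ⊕ w < y]; transitivity and
   descent on [y] do the rest. *)
move=> /lt_oexpw_split[z [a [w [yE wa]]]].
have Py : P (z ⊕ w) y by rewrite yE; exact: Pstep.
rewrite le_eqVlt => /predU1P[-> //|xz]; apply: Ptrans Py; apply: IH xz.
by rewrite yE lt_nsum2l.
Qed.

(* [(x - x')(y - y') > 0], with the negative terms moved across. *)
Definition cross_lt (x' x y' y : Ord) : Prop :=
  x' ⊗ y ⊕ x ⊗ y' < x ⊗ y ⊕ x' ⊗ y'.

Lemma cross_ltC x' x y' y : cross_lt x' x y' y -> cross_lt y' y x' x.
Proof.
by rewrite /cross_lt ![y' ⊗ _]nprodC ![y ⊗ _]nprodC [X in X < _]nsumC.
Qed.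

(** The products [(x - x')(y2 - y1)] and [(x - x')(y3 - y2)] add up to [(x - x')(y3 - y1)]; in the
    monoid, the terms in [y2] occur on both sides and cancel. *)
Lemma cross_lt_trans x' x y1 y2 y3 :
  cross_lt x' x y1 y2 -> cross_lt x' x y2 y3 -> cross_lt x' x y1 y3.
Proof.
move=> H12 /ltW H23; have := lt_le_nsum H12 H23; rewrite /cross_lt.
rewrite -[X in _ -> is_true X](lt_nsum2r (x' ⊗ y2 ⊕ x ⊗ y2)).
by congr (is_true (_ < _)); nsum_ac.
Qed.

Lemma cross_lt_shift x' x z y' y :
  cross_lt x' x y' y -> cross_lt x' x (z ⊕ y') (z ⊕ y).
Proof.
rewrite /cross_lt -(lt_nsum2r (x' ⊗ z ⊕ x ⊗ z)) !nprodDr.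
by congr (is_true (_ < _)); nsum_ac.
Qed.

(** Both mixed products lie below [oexpw (a ⊕ b)], hence so does their natural sum. *)
Lemma cross_lt_oexpw w a v b : w < oexpw a -> v < oexpw b ->
  cross_lt w (oexpw a) v (oexpw b).
Proof.
move=> wa vb; rewrite /cross_lt nprod_oexpw; apply: lt_le_trans (le_nsuml _ _).
apply: nsum_lt_oexpw; first exact: nprod_lt_oexpw.
by rewrite nprodC nsumC nprod_lt_oexpw.
Qed.

(** [lt_nsum_ind] in each variable, with common summands removed by shifting, reduces the claim to
    [cross_lt_oexpw]. *)
Lemma nprod_cross_lt x' x y' y : x' < x -> y' < y -> cross_lt x' x y' y.
Proof.
move=> + yy; move: x' x; apply: lt_nsum_ind => [x1 x2 x3 H12 H23|z w a wa].
  exact/cross_ltC/(cross_lt_trans (cross_ltC H12))/cross_ltC.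
apply/cross_ltC/cross_lt_shift/cross_ltC.
move: y' y yy; apply: lt_nsum_ind => [y1 y2 y3|{}z v b vb].
  exact: cross_lt_trans.
exact/cross_lt_shift/cross_lt_oexpw.
Qed.

(** * Cofinality of the differences below a product *)

Lemma lt_nprod_split x y z : z < x ⊗ y -> exists x0 a w,
  [/\ x = x0 ⊕ oexpw a, w < oexpw a ⊗ y & z <= x0 ⊗ y ⊕ w].
Proof.
elim/oexpw_ind: x z => [|x a IH] z; first by rewrite nprod0x lt0F.
rewrite nprodDl => /lt_nsum_split[[x' /IH[x0 [b [w [-> wb xw]]]] zx]|[w wa zw]].
  exists (x0 ⊕ oexpw a), b, w; split=> //; first by rewrite nsumAC.
  by rewrite nprodDl nsumAC; apply: le_trans zx _; rewrite le_nsum2r.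
by exists x, a, w.
Qed.

Lemma le_mono a b n : a <= b -> omono a n <= omono b n.
Proof.
rewrite le_eqVlt => /predU1P[-> //|ab]; case: n => [|n]; first by rewrite !mono0.
apply/ltW/lt_coefP; exists b; first by rewrite !coef_mono gt_eqF // eqxx.
by move=> c bc; rewrite !coef_mono !gt_eqF // (lt_trans ab).
Qed.

Lemma mono_lt_oexpw a b n : a < b -> omono a n < oexpw b.
Proof.
move=> ab; apply/lt_oexpwP => c; rewrite coef_mono.
by case: (c =P a) => // ->.
Qed.

Lemma lt_oexpw_mono z a : z < oexpw a ->
  z = ozero \/ exists b n, b < a /\ z <= omono b n.
Proof.
move=> /lt_oexpw_ex[|[b ba /lt_omega_div[n [r [rb ->]]]]]; [by left|right].
by exists b, n.+1; split=> //; apply/ltW/lt_omul => //; apply: lt_ofnat.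
Qed.

(** Monomials [omono c n] with [c < a ⊕ b] are cofinal here. Splitting the exponent [c] lowers [a]
    or [b], and the coefficient [n] goes to the factor whose exponent was lowered. *)
Lemma lt_oexpw_nsum w a b : w < oexpw (a ⊕ b) ->
  (exists2 u, u < oexpw a & w <= u ⊗ oexpw b) \/
  (exists2 v, v < oexpw b & w <= oexpw a ⊗ v).
Proof.
move=> /lt_oexpw_mono[->|[c [n [/lt_nsum_split[[a' aa ca]|[b' bb cb]] wc]]]].
- by left; exists ozero; rewrite ?oexpw_gt0 ?ole0.
- left; exists (omono a' n); first exact: mono_lt_oexpw.
  by rewrite -mono1 nprod_mono muln1; apply: le_trans wc (le_mono _ _).
- right; exists (omono b' n); first exact: mono_lt_oexpw.
  by rewrite -mono1 nprod_mono mul1n; apply: le_trans wc (le_mono _ _).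
Qed.

Lemma nprod_cofinal x y z : z < x ⊗ y -> exists x' y' d,
  [/\ x' < x, y' < y, z <= d & d ⊕ x' ⊗ y' = x' ⊗ y ⊕ x ⊗ y'].
Proof.
(* Split [x] first; the rest [w] lies below [oexpw a ⊗ y], so after commuting the same lemma splits
   [y]. *)
move=> /lt_nprod_split[x0 [a [w [xE]]]]; rewrite nprodC.
move=> /lt_nprod_split[y0 [b [w' [yE]]]].
rewrite [oexpw b ⊗ _]nprodC nprod_oexpw => w'ab ww' zw.
(* [d0] is the part of the difference shared by both choices of [x'] and [y']: the expansion of
   [x ⊗ y] without [oexpw a ⊗ oexpw b]. *)
pose d0 := x0 ⊗ y ⊕ y0 ⊗ oexpw a.
have {ww'}zw : z <= d0 ⊕ w'.
  by apply: le_trans zw _; rewrite -nsumA le_nsum2l.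
have [[u ua wu]|[v vb wv]] := lt_oexpw_nsum w'ab.
  exists (x0 ⊕ u), y0, (d0 ⊕ u ⊗ oexpw b); split.
  - by rewrite xE lt_nsum2l.
  - by rewrite yE -{1}[y0]nsumx0 lt_nsum2l oexpw_gt0.
  - by apply: le_trans zw _; rewrite le_nsum2l.
  - rewrite /d0 xE yE !nprodDl !nprodDr [y0 ⊗ _]nprodC; nsum_ac.
exists x0, (y0 ⊕ v), (d0 ⊕ oexpw a ⊗ v); split.
- by rewrite xE -{1}[x0]nsumx0 lt_nsum2l oexpw_gt0.
- by rewrite yE lt_nsum2l.
- by apply: le_trans zw _; rewrite le_nsum2l.
- rewrite /d0 xE yE !nprodDl !nprodDr [y0 ⊗ _]nprodC; nsum_ac.
Qed.

(** * Differences in the Grothendieck group and the recursive rules *)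

Lemma sequent_eq (A : set Ord) z : (forall a, A a -> a < z) ->
  (forall u, u < z -> exists2 a, A a & u <= a) -> sequent A = z.
Proof.
move=> Az zA; apply/le_anti; rewrite sequent_le //= leNgt; apply/negP.
by move=> /zA[a Aa]; rewrite leNgt (lt_sequent Az Aa).
Qed.

Lemma Wp_lt alpha (X : Wp alpha) : \val X < principal alpha.
Proof. exact: (set_mem (valP X)). Qed.

Lemma Wp_val alpha z : z < principal alpha -> exists X : Wp alpha, \val X = z.
Proof. by move=> h; exists (exist _ z (mem_set h)). Qed.

Lemma groth_relE alpha (u v : Wp alpha * Wp alpha) :
  groth_rel u v <-> \val u.1 ⊕ \val v.2 = \val v.1 ⊕ \val u.2.
(* Cancellation removes [k]; conversely any element may serve as [k], and [u.1] is at hand. *)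
Proof. by split=> [[k /nsumIr]//|E]; exists u.1; rewrite E. Qed.

Lemma gdiff_eq alpha (A B C D : Wp alpha) :
  gdiff A B = gdiff C D <-> \val A ⊕ \val D = \val C ⊕ \val B.
Proof.
split=> [/(congr1 sval)/= E|E].
  have : groth_rel (C, D) (C, D) by exact/groth_relE.
  by rewrite -E => /groth_relE.
apply: eq_exist => /=; apply/seteqP.
by split=> -[u v] /groth_relE /= H; apply/groth_relE/coef_inj => t /=;
  move: (congr1 (coef^~ t) H) (congr1 (coef^~ t) E); rewrite /= !coef_nsum; lia.
Qed.

Lemma gembed_eq alpha (A B D : Wp alpha) :
  gdiff A B = gembed D <-> \val D ⊕ \val B = \val A.
Proof. by rewrite gdiff_eq nsumx0; split. Qed.

(** The agreement of [add] with [⊕] is assumed only at the arguments the rule consults. The lemma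
    therefore both verifies the rule for the natural sum and serves as the induction step of the
    converse; [rule_mul_at] has the same form. *)
Lemma rule_add_at alpha (add : Wp alpha -> Wp alpha -> Wp alpha)
    (X Y : Wp alpha) :
  (forall X', below X X' -> \val (add X' Y) = \val X' ⊕ \val Y) ->
  (forall Y', below Y Y' -> \val (add X Y') = \val X ⊕ \val Y') ->
  sequent ([set \val (add X Y') | Y' in below Y] `|`
           [set \val (add X' Y) | X' in below X])%classic = \val X ⊕ \val Y.
Proof.
move=> addl addr; apply: sequent_eq => [_ [[Y' yy <-]|[X' xx <-]]|u].
- by rewrite addr // lt_nsum2l.
- by rewrite addl // lt_nsum2r.
case/lt_nsum_split=> [[X' xx ux]|[Y' yy uy]].
  have [U UE] := Wp_val (lt_trans xx (Wp_lt X)); rewrite -UE in xx ux.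
  by exists (\val U ⊕ \val Y) => //; right; exists U; rewrite ?addl.
have [V VE] := Wp_val (lt_trans yy (Wp_lt Y)); rewrite -VE in yy uy.
by exists (\val X ⊕ \val V) => //; left; exists V; rewrite ?addr.
Qed.

Lemma rule_mul_at alpha gamma (add mul : Wp alpha -> Wp alpha -> Wp alpha)
    (X Y : Wp alpha) :
  principal alpha < gamma -> is_natural_sum add ->
  (forall X', below X X' -> \val (mul X' Y) = \val X' ⊗ \val Y) ->
  (forall Y', below Y Y' -> \val (mul X Y') = \val X ⊗ \val Y') ->
  (forall X' Y', below X X' -> below Y Y' ->
    \val (mul X' Y') = \val X' ⊗ \val Y') ->
  sequent (ordinals_in [set gdiff (add (mul X' Y) (mul X Y')) (mul X' Y')
                       | X' in below X & Y' in below Y]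
           `&` W (osucc gamma))%classic = \val X ⊗ \val Y.
Proof.
move=> hgamma addE mull mulr mullr; apply: sequent_eq => [_ [[d +] <- _]|u].
  move=> [X' xx [Y' yy /gembed_eq]]; rewrite addE mull // mulr // mullr // => E.
  (* [E] reads [d ⊕ X'Y' = X'Y ⊕ XY'], so cancelling [X'Y'] in the cross inequality leaves
     [d < XY]. *)
  by have := nprod_cross_lt xx yy; rewrite /cross_lt -E lt_nsum2r.
move=> /nprod_cofinal[X' [Y' [d [xx yy ud]]]].
have [U UE] := Wp_val (lt_trans xx (Wp_lt X)).
have [V VE] := Wp_val (lt_trans yy (Wp_lt Y)); subst X' Y'.
rewrite -mull // -mulr // -mullr // -addE => dE.
(* [d] is at most [X'Y ⊕ XY'], a value of [add] and hence already in [Wp alpha]. *)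
have dlt : d < principal alpha.
  by apply: le_lt_trans (Wp_lt (add (mul U Y) (mul X V))); rewrite -dE le_nsuml.
have [N NE] := Wp_val dlt; subst d; exists (\val N) => //; split.
  by exists N => //; exists U => //; exists V => //; apply/gembed_eq.
(* Since [d < principal alpha < gamma], this difference survives the intersection with
   [W (osucc gamma)]. *)
by rewrite /W /= lt_osucc ltW // (lt_trans dlt).
Qed.

(** Lexicographic induction. The first hypothesis allows every [Y'], as the product rule consults
    both [(X', Y)] and [(X', Y')]. *)
Lemma Wp_ind2 alpha (P : Wp alpha -> Wp alpha -> Prop) :
  (forall X Y, (forall X' Y', below X X' -> P X' Y') ->
    (forall Y', below Y Y' -> P X Y') -> P X Y) -> forall X Y, P X Y.
Proof.
move=> H X Y; move: {2}(\val X) (erefl (\val X)) => u; move: X Y.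
elim/olt_ind: u => u IHx X Y xu; move: {2}(\val Y) (erefl (\val Y)) => v.
move: Y; elim/olt_ind: v => v IHy Y yv.
apply: H => [X' Y' xx|Y' yy]; last by apply: (IHy (\val Y')); rewrite -?yv.
by apply: (IHx (\val X')); rewrite -?xu.
Qed.

Theorem corollary4 (alpha gamma : Ord) (hgamma : principal alpha < gamma)
  (add mul : Wp alpha -> Wp alpha -> Wp alpha) :
  (is_natural_sum add /\ is_natural_product mul) <->
  (rule_add add /\ rule_mul gamma add mul).
Proof.
split=> [[addE mulE]|[addR mulR]].
  split=> x y; first by rewrite rule_add_at.
  by rewrite rule_mul_at.
have addE : is_natural_sum add.
  apply: Wp_ind2 => x y IHx IHy; rewrite addR rule_add_at // => x' xx.
  exact: IHx.
split=> //; apply: Wp_ind2 => x y IHx IHy; rewrite mulR rule_mul_at //.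
- by move=> x' xx; apply: IHx.
- by move=> x' y' xx yy; apply: IHx.
Qed.
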